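(* For all positive integers $\ell$ and $\Delta$, \[ \chi'(\ell,\Delta) \le 2 \sqrt{2 \ell}\, \Delta - \sqrt{2 \ell} + 2. \] Equivalently: for any $\ell$ finite simple loopless graphs $G_1,\ldots,G_\ell$ on a common vertex set $V$, each of maximum degree at most $\Delta$, there is an edge-coloring of their union $G$ using at most $2 \sqrt{2 \ell}\, \Delta - \sqrt{2 \ell} + 2$ colors whose restriction to the edge set of each $G_i$ is a proper edge-coloring.
   Context: All graphs are finite, simple and loopless. A (proper) edge-coloring of a graph is a coloring of its edges such that any two edges sharing an endpoint receive distinct colors. The union of graphs $G_1,\ldots,G_\ell$ on the same vertex set $V$ is the simple graph $G$ on $V$ in which $uv$ is an edge iff $uv$ is an edge of at least one $G_i$. An edge-coloring of $G$ is simultaneous with respect to $G_1,\ldots,G_\ell$ if its restriction to the edge set of each $G_i$ is a proper edge-coloring of $G_i$. $\chi'(G_1,\ldots,G_\ell)$ denotes the minimum number of colors of a simultaneous edge-coloring of their union, and $\chi'(\ell,\Delta)$ denotes the largest integer $k$ such that $k=\chi'(G_1,\ldots,G_\ell)$ for some graphs $G_1,\ldots,G_\ell$ on a common vertex set, each of maximum degree at most $\Delta$. *)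

(* Defs.v *)
From mathcomp Require Import all_boot all_order all_algebra.
Set Implicit Arguments.
Unset Strict Implicit.
Unset Printing Implicit Defensive.

Record sgraph (V : finType) := SGraph {
  adj :> rel V;
  adj_sym : symmetric adj;
  adj_irrefl : irreflexive adj }.

Definition edges (V : finType) (G : sgraph V) : {set {set V}} :=
  [set e : {set V} | [exists u, exists v, G u v && (e == [set u; v])]].

Definition edge (V : finType) (G : sgraph V) : finType :=
  {e : {set V} | e \in edges G}.

Definition max_degree (V : finType) (G : sgraph V) : nat :=
  \max_(v : V) #|[set u | G v u]|.

Definition proper_edge_coloring (V : finType) (G : sgraph V) (C : finType)
    (c : edge G -> C) : bool :=
  [forall e : edge G, forall f : edge G,
     (e != f) && (val e :&: val f != set0) ==> (c e != c f)].

Section Union.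
Variables (V : finType) (l : nat) (G : 'I_l -> sgraph V).

Definition union_adj : rel V := fun u v => [exists i, G i u v].

Lemma union_adj_sym : symmetric union_adj.
Proof. by move=> u v; apply: eq_existsb => i; apply: adj_sym. Qed.

Lemma union_adj_irrefl : irreflexive union_adj.
Proof. by move=> u; apply/existsP => -[i]; rewrite adj_irrefl. Qed.

Definition graph_union : sgraph V := SGraph union_adj_sym union_adj_irrefl.

Lemma edges_union (i : 'I_l) (e : {set V}) :
  e \in edges (G i) -> e \in edges graph_union.
Proof.
rewrite !inE => /existsP[u /existsP[v /andP[Guv e_uv]]].
apply/existsP; exists u; apply/existsP; exists v; rewrite e_uv andbT.
by apply/existsP; exists i.
Qed.

Definition edge_incl (i : 'I_l) (e : edge (G i)) : edge graph_union :=
  exist _ (val e) (edges_union (valP e)).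

Definition simultaneous (C : finType) (c : edge graph_union -> C) : bool :=
  [forall i : 'I_l, proper_edge_coloring (fun e : edge (G i) => c (edge_incl e))].

Definition simultaneously_colorable (k : nat) : bool :=
  [exists c : {ffun edge graph_union -> 'I_k}, simultaneous c].

Lemma ex_simultaneously_colorable : exists k, simultaneously_colorable k.
Proof.
exists #|edge graph_union|; apply/existsP; exists [ffun e => enum_rank e].
apply/forallP => i; apply/forallP => e; apply/forallP => f.
apply/implyP => /andP[ne_ef _]; rewrite !ffunE.
apply: contra ne_ef => /eqP/enum_rank_inj/(congr1 val)/= eq_ef.
by apply/eqP/val_inj.
Qed.

Definition sim_chromatic_index : nat := ex_minn ex_simultaneously_colorable.

End Union.

Definition sim_chromatic_index_value (l D k : nat) : Prop :=
  exists (V : finType) (G : 'I_l -> sgraph V),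
    (forall i, max_degree (G i) <= D) /\ sim_chromatic_index G = k.

(* A relation rather than a function of l and D: a largest value is not known
   a priori to exist; when it does, it is unique. *)
Definition is_max_sim_chromatic_index (l D k : nat) : Prop :=
  sim_chromatic_index_value l D k /\
  forall j, sim_chromatic_index_value l D j -> j <= k.

(* Main.v *)
(** Order the edges of the union by decreasing multiplicity (the number of
    graphs G_i containing the edge) and color greedily.  Let [e] have
    multiplicity [m].  At each endpoint at most [m (D - 1)] edges conflict with
    [e]; since the multiplicities at a vertex sum to at most [l D], at most
    [l D / m - 1] edges other than [e] at that endpoint have multiplicity at
    least [m].  Hence the number [d] of earlier conflicts satisfies
    [d <= 2 m (D - 1)] and [m (d + 2) <= 2 l D].  Eliminating [m] gives
    [(d + 1)^2 <= 4 l D (D - 1) + 1 <= l (2 D - 1)^2], which is even stronger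
    than the claim by a factor [sqrt 2]. *)

Require Import Defs.
From Stdlib Require Import Classical.
From mathcomp Require Import all_boot all_order all_algebra.
From mathcomp Require Import zify.
Import Order.TTheory GRing.Theory Num.Theory.
Local Open Scope ring_scope.

(** Either the bound [N] is attained or it can be lowered by one. The case split is classical
    because [P] will quantify over all finite graphs. *)
Lemma ex_max_nat (P : nat -> Prop) (N : nat) :
  (exists n, P n) -> (forall n, P n -> (n <= N)%N) ->
  exists k, P k /\ forall j, P j -> (j <= k)%N.
Proof.
move=> exP; elim: N => [|N IHN] leN.
  case: exP => n Pn; exists n; split=> // j /leN.
  by rewrite leqn0 => /eqP->.
case: (classic (P N.+1)) => [PN|nPN]; first by exists N.+1.
apply: IHN => n Pn; have := leN n Pn.
by rewrite leq_eqVlt => /orP[/eqP eq_n|//]; case: nPN; rewrite -eq_n.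
Qed.

(** Coloring by decreasing weight is run as an induction on the set to color: an element of least
    weight is removed, the rest is colored, and the removed element receives a free color. *)
Lemma greedy_coloring (T : finType) (r : rel T) (w : T -> nat) (k : nat) :
    symmetric r -> irreflexive r ->
    (forall x, #|[set y | r x y & (w x <= w y)%N]| < k)%N ->
  exists c : T -> 'I_k, forall x y, r x y -> c x != c y.
Proof.
move=> r_sym r_irr; case: k => [|k] few.
  by exists (fun x => False_rect _ (notF (few x))) => x; have := few x.
suff colorA n (A : {set T}) : #|A| = n -> exists c : T -> 'I_k.+1,
    {in A &, forall x y, r x y -> c x != c y}.
  have [c cP] := colorA _ [set: T] erefl.
  by exists c => x y; apply: cP; rewrite inE.
elim: n A => [|n IHn] A cardA.
  by exists (fun=> ord0) => x y; rewrite (cards0_eq cardA) inE.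
have /card_gt0P[x0 Ax0] : (0 < #|A|)%N by rewrite cardA.
have [x Ax minx] : exists2 x, x \in A & forall y, y \in A -> (w x <= w y)%N.
  by case: (arg_minnP w Ax0) => x; exists x.
have [c cP] : exists c : T -> 'I_k.+1,
    {in A :\ x &, forall y z, r y z -> c y != c z}.
  by apply: IHn; move: cardA; rewrite (cardsD1 x) Ax => -[].
(* Since [x] has least weight in [A], this contains the colors of all its neighbors in [A].
   Neighbors outside [A] may be counted too, but [few] covers them. *)
pose used := c @: [set y | r x y & (w x <= w y)%N].
have /card_gt0P[a] : (0 < #|~: used|)%N.
  have := leq_ltn_trans (leq_imset_card c _) (few x).
  by rewrite -/used -[X in (_ < X)%N]card_ord -(cardsC used); lia.
rewrite inE => a_free.
have fresh y : y \in A -> r x y -> a != c y.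
  move=> Ay rxy; apply: contraNneq a_free => ->.
  by apply: imset_f; rewrite inE rxy minx.
exists (fun y => if y == x then a else c y) => y z Ay Az ryz.
case: (eqVneq y x) => [eq_y|ne_y]; case: (eqVneq z x) => [eq_z|ne_z].
- by move: ryz; rewrite eq_y eq_z r_irr.
- by apply: fresh => //; rewrite -eq_y.
- by rewrite eq_sym; apply: fresh => //; rewrite -eq_z r_sym.
- by apply: cP; rewrite // !inE ?ne_y ?ne_z.
Qed.

Lemma leq_card_bigcup {I T : finType} (P : pred I) (F : I -> {set T}) :
  (#|\bigcup_(i | P i) F i| <= \sum_(i | P i) #|F i|)%N.
Proof.
elim/big_rec2: _ => [|i n A _ leA]; first by rewrite cards0.
by apply: leq_trans (leq_card_setU _ _) _; rewrite leq_add2l.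
Qed.

Lemma edgesP (V : finType) (G : sgraph V) (a : {set V}) :
  reflect (exists u v, G u v /\ a = [set u; v]) (a \in edges G).
Proof.
rewrite inE; apply: (iffP existsP) => [[u /existsP[v /andP[Guv /eqP->]]]|].
  by exists u, v.
by case=> u [v [Guv ->]]; exists u; apply/existsP; exists v; rewrite Guv eqxx.
Qed.

Definition star {V : finType} (G : sgraph V) (x : V) : {set {set V}} :=
  [set a in edges G | x \in a].

Lemma card_star {V : finType} (G : sgraph V) (x : V) :
  (#|star G x| <= max_degree G)%N.
Proof.
apply: leq_trans (leq_bigmax x).
apply: leq_trans (leq_imset_card (fun u => [set x; u]) _).
apply/subset_leq_card/subsetP => a; rewrite inE => /andP[/edgesP[u [v [Guv ->]]]].
rewrite !inE => /orP[] /eqP->; apply/imsetP.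
  by exists v; rewrite ?inE.
by exists u; rewrite ?inE 1?adj_sym // setUC.
Qed.

Section Conflicts.
Variables (V : finType) (l : nat) (G : 'I_l -> sgraph V).

(** The cardinality is the multiplicity of [a]. *)
Definition labels (a : {set V}) : {set 'I_l} := [set i | a \in edges (G i)].

Lemma mem_labels (a : {set V}) (i : 'I_l) :
  (i \in labels a) = (a \in edges (G i)).
Proof. by rewrite inE. Qed.

(** The relation lives on all vertex sets, which avoids the subtype of edges: a set that is no edge
    has no labels and conflicts with nothing. *)
Definition conflict : rel {set V} := fun a b =>
  [&& a != b, a :&: b != set0 & labels a :&: labels b != set0].

Lemma conflict_sym : symmetric conflict.
Proof.
by move=> a b; rewrite /conflict eq_sym (setIC a) (setIC (labels a)).
Qed.

Lemma conflict_irrefl : irreflexive conflict.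
Proof. by move=> a; rewrite /conflict eqxx. Qed.

Lemma conflict_simultaneously_colorable (k : nat) (c : {set V} -> 'I_k) :
  (forall a b, conflict a b -> c a != c b) -> simultaneously_colorable G k.
Proof.
move=> cP; apply/existsP; exists [ffun e => c (val e)].
apply/forallP => i; apply/forallP => e; apply/forallP => f.
apply/implyP => /andP[ne_ef meet]; rewrite !ffunE /=.
apply: cP; rewrite /conflict (inj_eq val_inj) ne_ef meet /=.
by apply/set0Pn; exists i; rewrite inE !mem_labels (valP e) (valP f).
Qed.

Definition heavy_conflicts (a : {set V}) : {set {set V}} :=
  [set b | conflict a b & (#|labels a| <= #|labels b|)%N].

Variable D : nat.
Hypothesis degG : forall i, (max_degree (G i) <= D)%N.

Lemma card_starD (i : 'I_l) (x : V) : (#|star (G i) x| <= D)%N.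
Proof. exact: leq_trans (card_star _ _) (degG i). Qed.

Let at_vertex (a : {set V}) (x : V) := [set b in heavy_conflicts a | x \in b].

(** Each such conflict lies in the star at [x] of some graph containing [a], and [a] itself takes
    one of the at most [D] places there. *)
Lemma card_at_vertex_degree (a : {set V}) (x : V) : x \in a ->
  (#|at_vertex a x| <= #|labels a| * D.-1)%N.
Proof.
move=> ax.
have sub : at_vertex a x \subset
    \bigcup_(i in labels a) (star (G i) x :\ a).
  apply/subsetP => b; rewrite !inE => /andP[/andP[/and3P[ne_ab _ /set0Pn[i]]]].
  rewrite inE !mem_labels => /andP[ai bi] _ bx.
  by apply/bigcupP; exists i; rewrite ?mem_labels // in_setD1 eq_sym ne_ab inE bi.
apply: leq_trans (subset_leq_card sub) _.
apply: leq_trans (leq_card_bigcup _ _) _.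
rewrite -sum_nat_const; apply: leq_sum => i; rewrite mem_labels => ai.
have := card_starD i x.
have star_a : a \in star (G i) x by rewrite inE ai.
by rewrite (cardsD1 a (star _ _)) star_a add1n; case: D.
Qed.

(** Double counting of pairs of an edge [b] in [M] and a label of [b]: each [b] has at least
    [#|labels a|] labels, and each label occurs on at most [D] edges at [x]. The successor accounts
    for [a]. *)
Lemma card_at_vertex_weight (a : {set V}) (x : V) : x \in a ->
  (#|labels a| * #|at_vertex a x|.+1 <= l * D)%N.
Proof.
move=> ax; pose M := a |: at_vertex a x.
have cardM : #|M| = #|at_vertex a x|.+1.
  by rewrite cardsU1 !inE conflict_irrefl.
have Mx b : b \in M -> x \in b /\ (#|labels a| <= #|labels b|)%N.
  rewrite /M !inE => /orP[/eqP->|/andP[/andP[_ ->] ->]] //.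
rewrite -cardM mulnC -sum_nat_const.
apply: (@leq_trans (\sum_(b in M) \sum_(i < l | b \in star (G i) x) 1)).
  apply: leq_sum => b /Mx[bx /leq_trans-> //].
  rewrite sum1_card; apply/subset_leq_card/subsetP => i.
  by rewrite mem_labels => bi; change (b \in star (G i) x); rewrite inE bi.
rewrite (exchange_big_dep xpredT) //=.
rewrite -[l in (_ <= l * _)%N]card_ord -sum_nat_const; apply: leq_sum => i _.
rewrite sum1_card; apply: leq_trans (card_starD i x).
by apply/subset_leq_card/subsetP => b; rewrite unfold_in => /andP[].
Qed.

Lemma card_heavy_conflicts (a : {set V}) : (0 < l)%N -> (0 < D)%N ->
  (#|heavy_conflicts a|.+1 ^ 2 <= l * (D.*2.-1) ^ 2)%N.
Proof.
move=> l_gt0 D_gt0.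
(* A conflict forces [a] to have a label, hence to be an edge with two endpoints. *)
case: (set_0Vmem (heavy_conflicts a)) => [->|[b]].
  by rewrite cards0; nia.
rewrite inE => /andP[/and3P[_ _ /set0Pn[i]]]; rewrite inE !mem_labels => /andP[ai _] _.
case/edgesP: (ai) => u [v [_ def_a]].
have au : u \in a by rewrite def_a !inE eqxx.
have av : v \in a by rewrite def_a !inE eqxx orbT.
have sub : heavy_conflicts a \subset at_vertex a u :|: at_vertex a v.
  apply/subsetP => c hc; rewrite in_setU !(in_set (fun b => (b \in _) && _)) hc /=.
  move: hc; rewrite inE => /andP[/and3P[_ /set0Pn[x xac] _] _]; move: xac.
  by rewrite def_a !inE => /andP[/orP[]/eqP-> ->]; rewrite ?orbT.
have := leq_trans (subset_leq_card sub) (leq_card_setU _ _).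
have := card_at_vertex_degree _ _ au; have := card_at_vertex_degree _ _ av.
have := card_at_vertex_weight _ _ au; have := card_at_vertex_weight _ _ av.
set m := #|labels a|; set d := #|heavy_conflicts a|.
move: #|at_vertex a u| #|at_vertex a v| => p q wq wp dq dp d_le.
have d1 : (d <= m * D.-1 * 2)%N by lia.
have d2 : (m * (d + 2) <= l * D * 2)%N by nia.
have d3 : (d * (d + 2) <= D.-1 * 2 * (l * D * 2))%N.
  apply: leq_trans (leq_mul (leqnn _) d2).
  by rewrite mulnA leq_mul2r [X in (_ <= X)%N]mulnC mulnA d1 orbT.
(* Adding 1 to both sides of [d3] completes the square on the left; on the right,
   $4D(D-1)+1=(2D-1)^2$ and $l \ge 1$. *)
by case: D D_gt0 d3 => // D' _ /=; nia.
Qed.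

Lemma sim_chromatic_index_sqr : (0 < l)%N -> (0 < D)%N ->
  (sim_chromatic_index G ^ 2 <= l * (D.*2.-1) ^ 2)%N.
Proof.
move=> l_gt0 D_gt0; rewrite /sim_chromatic_index; case: ex_minnP => -[//|k] _ kmin.
(* The index is [k.+1], so greedy coloring with [k] colors must fail at some [a] with at least [k]
   heavy conflicts. *)
have [few|] := boolP [forall a, #|heavy_conflicts a| < k]%N.
  have [c cP] := greedy_coloring _ _ (fun a => #|labels a|) _
    conflict_sym conflict_irrefl (forallP few).
  by have := kmin _ (conflict_simultaneously_colorable _ _ cP); rewrite ltnn.
rewrite negb_forall => /existsP[a]; rewrite -leqNgt => k_le.
by apply: leq_trans (card_heavy_conflicts a l_gt0 D_gt0); rewrite leq_exp2r.
Qed.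

End Conflicts.

Theorem theorem1 (R : rcfType) (l D : nat) (hl : (0 < l)%N) (hD : (0 < D)%N) :
  exists k : nat, is_max_sim_chromatic_index l D k /\
    k%:R <= 2 * Num.sqrt (2 * l%:R) * D%:R - Num.sqrt (2 * l%:R) + 2 :> R.
Proof.
have bound k : sim_chromatic_index_value l D k ->
    (k ^ 2 <= l * (D.*2.-1) ^ 2)%N.
  by case=> V [G [degG <-]]; apply: sim_chromatic_index_sqr.
have [|k Pk|k [Pk maxk]] :=
    @ex_max_nat (sim_chromatic_index_value l D) (l * (D.*2.-1) ^ 2).
(* The graph without vertices shows that some value is attained. *)
- pose G0 := @SGraph void (fun _ _ => false) (fun _ _ => erefl) (fun=> erefl).
  exists (sim_chromatic_index (fun _ : 'I_l => G0)), void, (fun=> G0); split=> // i.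
  by apply/bigmax_leqP => -[].
- by have := bound k Pk; nia.
exists k; split=> //; set s := Num.sqrt _.
have s_ge0 : 0 <= s by apply: sqrtr_ge0.
have -> : 2 * s * D%:R - s + 2 = s * (D.*2.-1)%:R + 2 :> R.
  rewrite -subn1 natrB ?double_gt0 // -muln2 natrM mulrBr mulr1.
  by rewrite [2 * s]mulrC -mulrA [2 * _]mulrC.
have : k%:R <= s * (D.*2.-1)%:R :> R; last first.
  by move=> /le_trans-> //; rewrite lerDl.
(* Both sides are nonnegative, so squares are compared: $k^2 \le l(2D-1)^2 \le 2l(2D-1)^2$. *)
rewrite -(@ler_pXn2r _ 2) ?nnegrE ?mulr_ge0 // exprMn sqr_sqrtr ?mulr_ge0 //.
rewrite -!natrX -!natrM ler_nat; apply: leq_trans (bound k Pk) _.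
by rewrite -mulnA leq_pmull.
Qed.
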